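(* For each natural number $n$, there exists a linear order of rank $n$ that is interpretable in $\mathbf{BA}_2$, i.e. (one-dimensionally) interpretable in the structure $(\mathbb{N};=,+,V_2)$.
   Context: Here $\mathbb{N}=\{0,1,2,\ldots\}$, and $V_2\colon\mathbb{N}\to\mathbb{N}$ is the unary function with $V_2(0)=0$ and, for $x>0$, $V_2(x)$ equal to the largest power of $2$ dividing $x$ (the power $2^k$ itself, not the exponent $k$). The Büchi arithmetic $\mathbf{BA}_2$ is the complete first-order theory $\mathrm{Th}(\mathbb{N};=,+,V_2)$. Interpretability: a linear order $(L,<)$ is (one-dimensionally, with not necessarily absolute equality) interpretable in $(\mathbb{N};=,+,V_2)$ if there are first-order formulas $\delta(x)$, $\epsilon(x,y)$, $\lambda(x,y)$ in the language $\{=,+,V_2\}$ such that, with $D=\{a\in\mathbb{N}: \mathbb{N}\models\delta(a)\}$ nonempty, $\epsilon$ defines an equivalence relation on $D$, $\lambda$ defines a binary relation on $D$ respecting this equivalence relation, and the quotient of $D$ by $\epsilon$ with the relation induced by $\lambda$ is isomorphic to $(L,<)$. Rank: let $(L,<)$ be a linear order. Define by transfinite recursion equivalence relations $\simeq_\alpha$ on $L$ for all ordinals $\alpha$: (1) $\simeq_0$ is equality; (2) $a\simeq_{\alpha+1}b$ if the set $\{c\in L\mid (a<c<b)\text{ or }(b<c<a)\}/{\simeq_\alpha}$ (the set of $\simeq_\alpha$-classes of elements strictly between $a$ and $b$) is finite; (3) $\simeq_\lambda=\bigcup_{\beta<\lambda}\simeq_\beta$ when $\lambda$ is a limit ordinal.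 The rank of $(L,<)$ is the smallest ordinal $\alpha$ such that $L/{\simeq_\alpha}$ is finite, or $\infty$ if no such $\alpha$ exists. *)

(* Defs.v *)
From mathcomp Require Import all_boot all_order.
From mathcomp Require Import boolp classical_sets functions cardinality.

Set Implicit Arguments.
Unset Strict Implicit.
Unset Printing Implicit Defensive.

Import Order.TTheory.

Local Open Scope classical_set_scope.
Local Open Scope order_scope.

Definition V2 (x : nat) : nat := if x == 0%N then 0%N else (2 ^ logn 2 x)%N.

(* The index of [term] and [formula] bounds the free variables: they are among
   the elements of 'I_n.  Quantifiers bind variable 0 and shift the others. *)
Inductive term (n : nat) : Type :=
| Var of 'I_n
| Plus of term n & term n
| TV2 of term n.

Inductive formula : nat -> Type :=
| Eq n of term n & term n : formula n
| Not n of formula n : formula n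
| And n of formula n & formula n : formula n
| Or n of formula n & formula n : formula n
| Implies n of formula n & formula n : formula n
| Exists n of formula n.+1 : formula n
| Forall n of formula n.+1 : formula n.

Fixpoint eval n (rho : n.-tuple nat) (t : term n) : nat :=
  match t with
  | Var i => tnth rho i
  | Plus t1 t2 => (eval rho t1 + eval rho t2)%N
  | TV2 t1 => V2 (eval rho t1)
  end.

Fixpoint holds n (phi : formula n) : n.-tuple nat -> Prop :=
  match phi with
  | Eq _ t1 t2 => fun rho => eval rho t1 = eval rho t2
  | Not _ f => fun rho => ~ holds f rho
  | And _ f g => fun rho => holds f rho /\ holds g rho
  | Or _ f g => fun rho => holds f rho \/ holds g rho
  | Implies _ f g => fun rho => holds f rho -> holds g rho
  | Exists _ f => fun rho => exists a : nat, holds f [tuple of a :: rho]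
  | Forall _ f => fun rho => forall a : nat, holds f [tuple of a :: rho]
  end.

Definition classes (T : Type) (R : T -> T -> Prop) (A : set T) : set (set T) :=
  [set [set y | R x y] | x in A].

Definition equivalence_on (T : Type) (A : set T) (R : T -> T -> Prop) : Prop :=
  [/\ forall x, A x -> R x x,
      forall x y, A x -> A y -> R x y -> R y x
    & forall x y z, A x -> A y -> A z -> R x y -> R y z -> R x z].

Definition respects (T : Type) (A : set T) (R S : T -> T -> Prop) : Prop :=
  forall x x' y y', A x -> A x' -> A y -> A y' ->
    R x x' -> R y y' -> (S x y <-> S x' y').

(* The truth values of [eps] and [lam] outside the domain are irrelevant, so
   both relations are cut down to the domain. *)
Definition interprets (d : Order.disp_t) (L : orderType d)
    (delta : formula 1) (eps lam : formula 2) : Prop :=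
  let D : set nat := [set a | holds delta [tuple a]] in
  let E a b := [/\ D a, D b & holds eps [tuple a; b]] in
  let S a b := [/\ D a, D b & holds lam [tuple a; b]] in
  [/\ D !=set0,
      equivalence_on D E,
      respects D E S
    & exists f : set nat -> L,
        set_bij (classes E D) setT f /\
        forall X Y, classes E D X -> classes E D Y ->
          ((exists a b, [/\ X a, Y b & S a b]) <-> f X < f Y)].

Definition interpretable_in_BA2 (d : Order.disp_t) (L : orderType d) : Prop :=
  exists (delta : formula 1) (eps lam : formula 2), interprets L delta eps lam.

(* Ordinals are represented by the elements w of a well-ordered type W; such a
   w stands for the order type of {v | v < w}. *)
Section Rank.

Variables (dW : Order.disp_t) (W : orderType dW).
Hypothesis ltW_wf : well_founded (fun v w : W => v < w).
Variables (d : Order.disp_t) (L : orderType d).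

Definition is_zero (w : W) : Prop := forall v, w <= v.

Definition is_succ (v w : W) : Prop := v < w /\ forall u, u < w -> u <= v.

Definition is_limit (w : W) : Prop := ~ is_zero w /\ forall v, ~ is_succ v w.

Definition strictly_between (a b : L) : set L :=
  [set c | a < c < b \/ b < c < a].

Definition condensation_step (w : W)
    (rec : forall v : W, v < w -> L -> L -> Prop) (a b : L) : Prop :=
  [\/ is_zero w /\ a = b,
      exists (v : W) (vw : v < w),
        is_succ v w /\ finite_set (classes (rec v vw) (strictly_between a b))
    | is_limit w /\ exists (v : W) (vw : v < w), rec v vw a b].

Definition condensation : W -> L -> L -> Prop :=
  Fix ltW_wf (fun _ => L -> L -> Prop) condensation_step.

Definition has_rank (w : W) : Prop :=
  finite_set (classes (condensation w) setT) /\
  forall v, v < w -> ~ finite_set (classes (condensation v) setT).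

End Rank.

Lemma ltn_wf : well_founded (fun m n : nat => m < n).
Proof.
move=> n; elim/ltn_ind: n => n IH.
by constructor=> m; rewrite ltEnat; exact: IH.
Qed.

(* Main.v *)
Require Import Defs.
From mathcomp Require Import all_boot all_order.
From mathcomp Require Import boolp classical_sets functions cardinality zify.

Set Implicit Arguments.
Unset Strict Implicit.
Unset Printing Implicit Defensive.

Import Order.TTheory.

Local Open Scope classical_set_scope.

(** The order is omega^n, realised as the n-tuples of natural numbers with the
    lexicographic order.

    Rank.  Each condensation of omega^n forgets one more trailing coordinate:
    for k <= n, two tuples are k-equivalent exactly when their first n - k
    coordinates agree ([condensation_agree]).  If a and b agree on their first
    n - k - 1 coordinates, so does everything between them, and a class of the
    k-th relation is then fixed by the next coordinate, which is bounded
    ([finite_classes_between]).  If they differ earlier, raising that next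
    coordinate of the smaller tuple never leaves the interval and yields
    infinitely many classes ([agree_finite_between]).  So the quotient is
    infinite for k < n and a single point for k = n.

    Interpretation.  A sequence a_1, ..., a_n is coded by the number with exactly
    n binary ones, in which a_i zeros immediately precede the i-th one when digits are
    read from the least significant end.  The function V_2 extracts the lowest one,
    and x - V_2(x) is the code of the remaining sequence up to a factor that is
    a power of 2.  Comparing V_2 first and then the remainders is the
    lexicographic order, and both this comparison and the property of being a
    code are insensitive to powers of 2.  So n successive removals of the lowest
    one define the codes and their order ([holds_code], [holds_lexi]); equality
    serves as the equivalence relation. *)

(** * Condensations indexed by natural numbers *)

Section FiniteCondensations.

Variables (d : Order.disp_t) (L : orderType d).

(** The recursive step involves proofs of [v < k], so unfolding the fixed point
    needs functional extensionality. *)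
Lemma condensationE (k : nat) :
  condensation ltn_wf k =
  condensation_step
    (fun (v : nat) (_ : (v < k)%O) => @condensation _ _ ltn_wf _ L v).
Proof.
apply: Fix_eq => w f g fg; congr condensation_step.
by apply: functional_extensionality_dep => v; apply: funext => vw.
Qed.

Lemma condensation0 (a b : L) : condensation ltn_wf 0%N a b <-> a = b.
Proof.
rewrite condensationE; split; last by move=> ->; constructor 1.
case=> [[]//|[v [vw _]]|[[nz] _]]; last by case: nz.
by rewrite ltEnat in vw.
Qed.

Lemma is_succ_nat (v k : nat) : is_succ v k.+1 <-> v = k.
Proof.
rewrite /is_succ; split=> [[vk vmax]|->].
  apply/eqP; rewrite eqn_leq -ltnS.
  have := vmax k; rewrite !ltEnat !leEnat /= in vk *.
  by move=> /(_ (ltnSn k)) ->; rewrite vk.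
by split=> [|u]; rewrite ltEnat ?leEnat /=.
Qed.

Lemma condensationS (k : nat) (a b : L) :
  condensation ltn_wf k.+1 a b <->
  finite_set (classes (condensation ltn_wf k) (strictly_between a b)).
Proof.
rewrite condensationE; split=> [|fin].
  case=> [[/(_ 0%N)]//|[v [vw [/is_succ_nat vk]]]|[[_ /(_ k) []]]].
    by subst v.
  exact/is_succ_nat.
constructor 2; exists k, (ltnSn k); split => //; exact/is_succ_nat.
Qed.

End FiniteCondensations.

(** * The rank of the lexicographic power *)

Section LexicographicPower.

Variable n : nat.
Local Notation L := (n.-tuplelexi nat).
Implicit Types a b c y : L.

(** Agreement on the first [n - k] coordinates; the form [i + k < n] avoids
    truncated subtraction. *)
Definition agree (k : nat) a b : Prop :=
  forall i : 'I_n, i + k < n -> tnth a i = tnth b i.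

(** The increment is [m.+1], so that the result is strictly above [a] even for
    [m = 0]. *)
Definition raise (p : 'I_n) a (m : nat) : L :=
  [tuple if i == p then tnth a p + m.+1 else tnth a i | i < n].

(** Coordinate [p] is among those compared by [agree k], so distinct raises of it
    are pairwise inequivalent. *)
Lemma classes_raise_infinite (k : nat) (p : 'I_n) a (A : set L) :
  p + k < n -> (forall m, A (raise p a m)) ->
  ~ finite_set (classes (agree k) A).
Proof.
move=> pk Araise fin; apply: infinite_nat.
pose f m := [set y | agree k (raise p a m) y].
suff <- : f @^-1` classes (agree k) A = setT.
  apply: finite_preimage fin => m m' _ _ fmm'.
  have : f m (raise p a m') by rewrite fmm' => i _.
  by move=> /(_ p pk); rewrite !tnth_mktuple eqxx; lia.
by apply/seteqP; split=> // m _; exists (raise p a m).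
Qed.

Lemma lt_raise (p : 'I_n) a m : (a < raise p a m)%O.
Proof.
apply/ltxi_tuplePlt; exists p => [i ip|]; rewrite tnth_mktuple.
  by rewrite -val_eqE /= ltn_eqF.
by rewrite eqxx ltEnat /=; lia.
Qed.

(** The comparison with [b] is already decided at the earlier coordinate [j],
    hence changing coordinate [p] cannot affect it. *)
Lemma raise_lt (j p : 'I_n) a b m :
  j < p -> (forall i : 'I_n, i < j -> tnth a i = tnth b i) ->
  tnth a j < tnth b j -> (raise p a m < b)%O.
Proof.
move=> jp eq_ab lt_ab; apply/ltxi_tuplePlt.
exists j => [i ij|]; rewrite tnth_mktuple -val_eqE /= ltn_eqF //.
  exact: eq_ab.
exact: ltn_trans ij jp.
Qed.

(** A first difference before [p], between [a] and [c] or between [c] and [b],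
    would force [a] and [b] themselves to differ before [p]. *)
Lemma lt_between (p : 'I_n) a b c :
  (forall i : 'I_n, i < p -> tnth a i = tnth b i) -> (a < c)%O -> (c < b)%O ->
  (forall i : 'I_n, i < p -> tnth c i = tnth a i) /\ tnth c p <= tnth b p.
Proof.
move=> ab /ltxi_tuplePlt[i eq_ac lt_ac] /ltxi_tuplePlt[j eq_cb lt_cb].
rewrite !ltEnat /= in lt_ac lt_cb.
have pi : p <= i.
  rewrite leqNgt; apply/negP=> ip; have abi := ab i ip.
  case: (ltngtP i j) => [ij|ji|/val_inj ij].
  - by rewrite eq_cb // abi ltnn in lt_ac.
  - by rewrite -eq_ac // ab ?ltnn // in lt_cb; apply: ltn_trans ip.
  - by subst j; rewrite abi in lt_ac; have := ltn_trans lt_ac lt_cb; rewrite ltnn.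
have ca (h : 'I_n) : h < p -> tnth c h = tnth a h.
  by move=> hp; rewrite (eq_ac h) // (leq_trans hp).
split=> //; case: (ltngtP p j) => [pj|jp|/val_inj ->].
- by rewrite (eq_cb p pj).
- by rewrite ca // ab // ltnn in lt_cb.
- exact: ltnW.
Qed.

(** Here [p] is the last coordinate seen by [agree k], the one that
    [agree k.+1] forgets. *)
Lemma agreeS (k : nat) (p : 'I_n) a b : p + k.+1 = n ->
  agree k a b <-> agree k.+1 a b /\ tnth a p = tnth b p.
Proof.
move=> pk; split=> [ab|[ab abp] i ik].
  by split=> [i ik|]; apply: ab; lia.
case: (eqVneq i p) => [->//|]; rewrite -val_eqE /= => ip.
by apply: ab; lia.
Qed.

(** The elements between [a] and [b] share their first [n - k.+1] coordinates,
    so their classes are indexed by the values of the next coordinate, which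
    cannot exceed those of [a] and [b]. *)
Lemma finite_classes_between (k : nat) a b : k < n ->
  agree k.+1 a b -> finite_set (classes (agree k) (strictly_between a b)).
Proof.
move=> kn ab.
have pn : n - k.+1 < n by lia.
pose p := Ordinal pn; have pk : p + k.+1 = n by rewrite /=; lia.
(* The class of every element between a and b whose coordinate p is m. *)
pose piece m := [set y | agree k.+1 a y /\ tnth y p = m].
apply: (@sub_finite_set _ _ (piece @` `I_(maxn (tnth a p) (tnth b p)).+1));
  last exact/finite_image/finite_II.
move=> _ [c cab <-].
have abp (i : 'I_n) : i < p -> tnth a i = tnth b i by move=> ip; apply: ab; lia.
have [ac cp] : agree k.+1 a c /\ tnth c p <= maxn (tnth a p) (tnth b p).
  case: cab => /andP[ac cb].
    have [ca cp] := lt_between abp ac cb.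
    by split=> [i ik|]; [rewrite ca //; lia | rewrite leq_max cp orbT].
  have bap (i : 'I_n) : i < p -> tnth b i = tnth a i by move=> /abp.
  have [ca cp] := lt_between bap ac cb.
  by split=> [i ik|]; [rewrite ca ?abp //; lia | rewrite leq_max cp].
exists (tnth c p) => //=.
apply/seteqP; split=> y /=.
  case=> ay yp; apply/(agreeS _ _ pk); split=> // i ik.
  by rewrite -ac // ay.
move=> /(agreeS _ _ pk)[cy cyp]; split=> // i ik.
by rewrite ac // cy.
Qed.

(** If the first difference [j] lies before the last coordinate [p] seen by
    [agree k], all raises of the smaller tuple at [p] stay between [a] and [b]. *)
Lemma agree_finite_between (k : nat) a b : k < n ->
  finite_set (classes (agree k) (strictly_between a b)) -> agree k.+1 a b.
Proof.
move=> kn; wlog lt_ab : a b / (a < b)%O => [wl fin|fin].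
  case: (ltgtP a b) => [ab|ba|->//].
    exact: wl.
  suff ba' : agree k.+1 b a by move=> i /ba'.
  apply: wl => //; congr (finite_set (classes _ _)): fin.
  by apply/seteqP; split=> c; rewrite /strictly_between /=; tauto.
case/ltxi_tuplePlt: (lt_ab) => j eq_ab lt_abj i ik.
have pn : n - k.+1 < n by lia.
pose p := Ordinal pn.
case: (leqP p j) => [pj|jp]; first by apply: eq_ab; rewrite /= in pj; lia.
case: (@classes_raise_infinite k p a (strictly_between a b)) => //=; first by lia.
move=> m; left; rewrite lt_raise /=; exact: raise_lt eq_ab lt_abj.
Qed.

Lemma condensation_agree (k : nat) : k <= n ->
  @condensation _ _ ltn_wf _ L k = agree k.
Proof.
elim: k => [|k IH] kn; apply/funext => a; apply/funext => b; apply/propext.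
  rewrite condensation0; split=> [-> //|ab].
  by apply: eq_from_tnth => i; apply: ab; rewrite addn0.
rewrite condensationS IH ?(ltnW kn) //; split.
  exact: agree_finite_between.
exact: finite_classes_between.
Qed.

Lemma tuplelexi_rank : has_rank ltn_wf L n.
Proof.
split=> [|k kn].
  rewrite condensation_agree //.
  apply: (@sub_finite_set _ _ [set setT]); last exact: finite_set1.
  move=> _ [a _ <-]; apply/seteqP; split=> // b _ i.
  by rewrite ltnNge leq_addl.
rewrite ltEnat /= in kn; rewrite condensation_agree; last exact: ltnW.
have n0 : 0 < n by lia.
exact: (@classes_raise_infinite _ (Ordinal n0) [tuple 0 | i < n]).
Qed.

End LexicographicPower.

(** * Coding sequences of natural numbers by binary expansions *)

(** Entries are gaps between consecutive binary ones, rather than their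
    positions, so that every sequence is a code and removing the head of a
    sequence removes the lowest one up to a power of 2. *)
Fixpoint code (s : seq nat) : nat :=
  if s is a :: s' then 2 ^ a * (code s').*2.+1 else 0.

Lemma V2_pow2_odd (k m : nat) : V2 (2 ^ k * m.*2.+1) = 2 ^ k.
Proof.
rewrite /V2 muln_eq0 expn_eq0 /= mulnC logn_Gauss ?pfactorK //.
by rewrite coprime2n /= odd_double.
Qed.

Lemma pow2_odd_decomp (x : nat) : x != 0 -> exists k m, x = 2 ^ k * m.*2.+1.
Proof.
rewrite -lt0n => /(pfactor_coprime (isT : prime 2))[m].
rewrite coprime2n => om ->; exists (logn 2 x), m./2.
by rewrite mulnC -{1}(odd_double_half m) om.
Qed.

Lemma pow2_odd_inj (k k' m m' : nat) :
  2 ^ k * m.*2.+1 = 2 ^ k' * m'.*2.+1 -> k = k' /\ m = m'.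
Proof.
move=> e; have := congr1 V2 e; rewrite !V2_pow2_odd => /eqP.
rewrite eqn_exp2l // => /eqP kk'; split=> //; move: e; rewrite kk' => /eqP.
by rewrite eqn_pmul2l ?expn_gt0 // => /eqP[]; lia.
Qed.

Lemma code_inj : injective code.
Proof.
elim=> [|a s IH] [|b t] //=.
- by move/esym/eqP; rewrite muln_eq0 expn_eq0.
- by move/eqP; rewrite muln_eq0 expn_eq0.
by move=> /pow2_odd_inj[-> /IH ->].
Qed.

(** * Definability of the codes and of their order *)

(** The language has no constant 0; in the natural numbers [x = x + x] says that
    [x] vanishes. *)
Definition is_zero_formula m (i : 'I_m) : formula m :=
  Eq (Var i) (Plus (Var i) (Var i)).

Definition V2_lt_formula m (i j : 'I_m) : formula m :=
  Exists (And (Eq (Plus (TV2 (Var (lift ord0 i))) (Var ord0))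
                  (TV2 (Var (lift ord0 j))))
              (Not (is_zero_formula ord0))).

(** Says that [j] is [i] with its lowest binary one removed. *)
Definition remainder_formula m (i j : 'I_m) : formula m :=
  Eq (Var i) (Plus (TV2 (Var i)) (Var j)).

(** This formula and the next take arbitrary variables of an arbitrary context, which
    makes them reusable under quantifiers without substitution. *)
Fixpoint code_formula (n m : nat) (i : 'I_m) : formula m :=
  if n is n'.+1 then
    And (Not (is_zero_formula i))
        (Exists (And (remainder_formula (lift ord0 i) ord0)
                     (code_formula n' ord0)))
  else is_zero_formula i.

Fixpoint lexi_formula (n m : nat) (i j : 'I_m) : formula m :=
  if n is n'.+1 then
    let i' := lift ord0 (lift ord0 i) in
    let j' := lift ord0 (lift ord0 j) in
    let u := lift ord0 ord0 in
    let v := ord0 in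
    Or (V2_lt_formula i j)
       (And (Eq (TV2 (Var i)) (TV2 (Var j)))
            (Exists (Exists
              (And (And (remainder_formula i' u) (remainder_formula j' v))
                   (lexi_formula n' u v)))))
  else Not (Eq (Var i) (Var i)).

Section Semantics.

Variables (m : nat) (rho : m.-tuple nat).

Lemma holds_is_zero (i : 'I_m) : holds (is_zero_formula i) rho <-> tnth rho i = 0.
Proof. by split=> /=; lia. Qed.

Lemma holds_V2_lt (i j : 'I_m) :
  holds (V2_lt_formula i j) rho <-> V2 (tnth rho i) < V2 (tnth rho j).
Proof.
rewrite /=; split=> [[z]|ij].
  by rewrite !tnthS tnth0; lia.
by exists (V2 (tnth rho j) - V2 (tnth rho i)); rewrite !tnthS tnth0; lia.
Qed.

End Semantics.

(** Removing the lowest one of a scaled code leaves the tail of the sequence,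
    scaled by a larger power of 2. *)
Lemma pow2_remainder (c a x u : nat) :
  2 ^ c * (2 ^ a * x.*2.+1) = V2 (2 ^ c * (2 ^ a * x.*2.+1)) + u <->
  u = 2 ^ (c + a).+1 * x.
Proof.
by rewrite mulnA -expnD V2_pow2_odd mulnS -mul2n mulnA -expnSr; split; lia.
Qed.

(** Removing the lowest binary one leaves a scaled code, so the induction on [n]
    needs the statement for every multiple [2 ^ c * x]. *)
Lemma holds_code (n m : nat) (rho : m.-tuple nat) (i : 'I_m) (c x : nat) :
  tnth rho i = 2 ^ c * x ->
  (holds (code_formula n i) rho <-> exists2 s, size s = n & code s = x).
Proof.
elim: n => [|n IH] in m rho i c x *; move=> ix.
  rewrite -[holds _ _]/(holds (is_zero_formula i) rho) (holds_is_zero rho i) ix.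
  split=> [/eqP|[[|//] _ <-]].
    by rewrite muln_eq0 expn_eq0 /= => /eqP->; exists [::].
  by rewrite muln0.
split=> [[/holds_is_zero ix0 [u []]]|[[//|a s] /eqP/[!eqSS]/eqP sn sx]].
  have /pow2_odd_decomp[a [y xy]] : x != 0.
    by apply/eqP => x0; apply: ix0; rewrite ix x0 muln0.
  rewrite /= tnthS tnth0 ix xy => /pow2_remainder uy.
  move=> /(IH _ [tuple of u :: rho] ord0 (c + a).+1 y uy)[s sn sy].
  by exists (a :: s); rewrite /= ?sn ?sy.
split; first by move/holds_is_zero/eqP; rewrite ix -sx /= !muln_eq0 !expn_eq0.
exists (2 ^ (c + a).+1 * code s); split.
  by rewrite /= tnthS tnth0 ix -sx; apply/pow2_remainder.
by apply/(IH _ _ ord0 (c + a).+1 (code s)) => //; exists s.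
Qed.

(** As in [holds_code], the factor [2 ^ c] is there for the induction.  When the
    heads are equal, both tails are scaled by the same power of 2, so a common
    factor suffices. *)
Lemma holds_lexi (n m : nat) (rho : m.-tuple nat) (i j : 'I_m) (c : nat)
    (s t : seqlexi nat) :
  size s = n -> size t = n ->
  tnth rho i = 2 ^ c * code s -> tnth rho j = 2 ^ c * code t ->
  (holds (lexi_formula n i j) rho <-> (s < t)%O).
Proof.
elim: n => [|n IH] in m rho i j c s t *.
  by move=> /size0nil -> /size0nil -> _ _; split=> //=.
case: s t => [//|a s] [//|b t] [sn] [tn] /= ix jx.
have Vi : V2 (tnth rho i) = 2 ^ (c + a) by rewrite ix mulnA -expnD V2_pow2_odd.
have Vj : V2 (tnth rho j) = 2 ^ (c + b) by rewrite jx mulnA -expnD V2_pow2_odd.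
have rest (u v : nat) : u = 2 ^ (c + a).+1 * code s ->
    v = 2 ^ (c + a).+1 * code t ->
    (holds (lexi_formula n (lift ord0 ord0) ord0) [tuple of v :: u :: rho]
      <-> ((s : seqlexi nat) < t)%O).
  by move=> us vt; apply: (IH _ _ _ _ (c + a).+1).
rewrite Order.SeqLexiOrder.ltxi_cons.
rewrite -[X in X \/ _]/(holds (V2_lt_formula i j) rho).
rewrite (holds_V2_lt rho i j) Vi Vj ltn_exp2l // ltn_add2l !leEnat; split.
  case=> [ab|[/eqP]]; first by rewrite ltnW //= implybE leqNgt ab.
  rewrite eqn_exp2l // eqn_add2l => /eqP ab; subst b.
  move=> [u [v [[]]]]; rewrite !tnthS !tnth0 ix jx.
  by move=> /pow2_remainder us /pow2_remainder vt /(rest _ _ us vt) ->; rewrite leqnn.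
case: ltngtP => [ab _|//|ab /= st]; first by left.
right; subst b; split=> //.
exists (2 ^ (c + a).+1 * code s), (2 ^ (c + a).+1 * code t).
rewrite !tnthS !tnth0 ix jx.
by split; [split; apply/pow2_remainder | apply/rest].
Qed.

Lemma tuplelexi_interpretable (n : nat) : interpretable_in_BA2 (n.-tuplelexi nat).
Proof.
exists (code_formula n ord0), (Eq (Var ord0) (Var (lift ord0 ord0))),
  (lexi_formula n ord0 (lift ord0 ord0)).
set D := [set a | holds (code_formula n ord0) [tuple a]].
set E := fun a b : nat => [/\ D a, D b &
  holds (Eq (Var ord0) (Var (lift ord0 ord0))) [tuple a; b]].
set S := fun a b : nat => [/\ D a, D b &
  holds (lexi_formula n ord0 (lift ord0 ord0)) [tuple a; b]].
have DP x : D x <-> exists t : n.-tuplelexi nat, code t = x.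
  have xE : tnth [tuple x] ord0 = 2 ^ 0 * x by rewrite mul1n.
  apply: iff_trans (holds_code n xE) _; split=> [[s sn <-]|[t <-]].
    by move/eqP: sn => sn; exists (Tuple sn).
  by exists t; rewrite ?size_tuple.
have Dcode (t : n.-tuplelexi nat) : D (code t) by apply/DP; exists t.
have lamP (s t : n.-tuplelexi nat) :
    holds (lexi_formula n ord0 (lift ord0 ord0)) [tuple code s; code t] <->
    (s < t)%O.
  by apply: (@holds_lexi _ _ _ _ _ 0 s t); rewrite ?size_tuple ?mul1n.
have EP a b : E a b <-> D a /\ a = b.
  by split=> [[Da _ ab]|[Da ab]]; [|subst b].
have Einj (s t : n.-tuplelexi nat) : E (code s) (code t) -> s = t.
  by move=> /EP[_ /code_inj/val_inj].
pose t0 : n.-tuplelexi nat := [tuple 0 | i < n].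
split.
- by exists (code t0); apply: Dcode.
- by split=> [x Dx|x y _ Dy /EP[_ ->]|x y z _ Dy _ /EP[_ ->] /EP[_ <-]]; apply/EP.
- by move=> x x' y y' _ _ _ _ /EP[_ ->] /EP[_ ->].
pose class (t : n.-tuplelexi nat) := [set y | E (code t) y].
(* The isomorphism decodes a class by choosing a tuple whose code lies in it;
   t0 is the value on sets that contain no code. *)
pose f (X : set nat) := xget t0 [set t | X (code t)].
have fK t : f (class t) = t.
  by apply: xget_unique => [|u /Einj //]; apply/EP.
have classP X : classes E D X -> exists t, X = class t.
  by case=> _ /DP[t <-] <-; exists t.
exists f; split.
  split=> // [X Y|t _].
    by rewrite !inE => /classP[s ->] /classP[t ->]; rewrite !fK => ->.
  by exists (class t); [exists (code t); first exact: Dcode|exact: fK].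
move=> _ _ /classP[s ->] /classP[t ->]; rewrite !fK; split.
  by move=> [_ [_ [/EP[_ <-] /EP[_ <-] [_ _ /lamP]]]].
move=> st; exists (code s), (code t); split; [exact/EP|exact/EP|].
by split; [exact: Dcode|exact: Dcode|exact/lamP].
Qed.

Theorem theorem2p5 (n : nat) :
  exists (d : Order.disp_t) (L : orderType d),
    has_rank ltn_wf L n /\ interpretable_in_BA2 L.
Proof.
exists _, (n.-tuplelexi nat); split; first exact: tuplelexi_rank.
exact: tuplelexi_interpretable.
Qed.
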